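(* Let $\mathcal{A}$ be a Boolean algebra and $\mathcal{I}$ a proper ideal in $\mathcal{A}$. The following are equivalent: (i) the algebra $\mathcal{A}\langle\mathcal{I}\rangle$ has the Nikodym property; (ii) for every $A\in\mathcal{I}$ the restricted algebra $\mathcal{A}_A$ has the Nikodym property, and there is no sequence $(\mu_n)$ of non-negative Radon measures on $St(\mathcal{A}\langle\mathcal{I}\rangle)$ such that (1) $p_{\mathcal{I}^*}\notin\operatorname{supp}(\mu_n)$ for every $n$, (2) $\sup_n\|\mu_n\|=\infty$, (3) $\lim_n\mu_n([A])=0$ for every $A\in\mathcal{I}$; (iii) the same as (ii) but with ''no disjointly supported sequence'' in place of ''no sequence''.
   Context: $\mathcal{A}_A=\{A\wedge B\colon B\in\mathcal{A}\}$ (a Boolean algebra with unit $A$). $\mathcal{A}\langle\mathcal{I}\rangle=\mathcal{I}\cup\mathcal{I}^*$ with $\mathcal{I}^*=\{1_{\mathcal{A}}\setminus A\colon A\in\mathcal{I}\}$, an ultrafilter of $\mathcal{A}\langle\mathcal{I}\rangle$, whose corresponding point in the Stone space $St(\mathcal{A}\langle\mathcal{I}\rangle)$ is $p_{\mathcal{I}^*}$. $[A]$ is the clopen set of ultrafilters containing $A$. Radon measures are regular $\sigma$-additive bounded Borel measures; $\operatorname{supp}$ is the support; disjointly supported means pairwise disjoint supports. A Boolean algebra has the Nikodym property if every sequence of bounded finitely additive real functions on it converging to $0$ at every element is bounded in the variation norm $\|\mu\|=\sup\{|\mu(A)|+|\mu(B)|\colon A\wedge B=0\}$. *)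

(* Defs.v *)
From HB Require Import structures.
From mathcomp Require Import all_boot all_order all_algebra.
From mathcomp Require Import all_classical all_reals all_analysis.

Set Implicit Arguments.
Unset Strict Implicit.
Unset Printing Implicit Defensive.

Import Order.Theory GRing.Theory Num.Theory.
Import numFieldNormedType.Exports.

Local Open Scope classical_set_scope.
Local Open Scope ring_scope.

(* Boolean algebras are the complemented distributive lattices with top and
   bottom, [ctbDistrLatticeType d]; the display [d] carries no content. *)

Record properIdeal (d : Order.disp_t) (A : ctbDistrLatticeType d) :=
  ProperIdeal {
    ideal_set : set A;
    ideal0 : ideal_set \bot%O;
    idealU : forall x y, ideal_set x -> ideal_set y -> ideal_set (x `|` y)%O;
    ideal_le : forall x y, (x <= y)%O -> ideal_set y -> ideal_set x;
    ideal1 : ~ ideal_set \top%O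
  }.

Section relAlg.
Context (d : Order.disp_t) (A : ctbDistrLatticeType d) (a : A).

(* [relAlg a] is the algebra A_a, with unit [a] and complement a /\ ~ x. *)
Definition rel_set : set A := [set (a `&` b)%O | b in [set: A]].

Record relAlg := RelAlg { rel_val : A; rel_valP : rel_val \in rel_set }.

HB.instance Definition _ := [isSub for rel_val].
HB.instance Definition _ := [Choice of relAlg by <:].

Lemma rel_setE (x : A) : (x \in rel_set) = (x <= a)%O.
Proof.
apply/idP/idP => [|xa]; first by rewrite inE => -[b _ <-]; exact: leIl.
by rewrite inE; exists x => //; exact/meet_idPr.
Qed.

Fact rel_setI : {in rel_set &, forall x y, (x `&` y)%O \in rel_set}.
Proof. by move=> x y; rewrite !rel_setE => xa _; rewrite leIxl. Qed.

Fact rel_setU : {in rel_set &, forall x y, (x `|` y)%O \in rel_set}.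
Proof. by move=> x y; rewrite !rel_setE leUx => -> ->. Qed.

Fact rel_set0 : \bot%O \in rel_set.
Proof. by rewrite rel_setE le0x. Qed.

HB.instance Definition _ := Order.SubChoice_isBSubLattice.Build d A
  (fun x => x \in rel_set) d relAlg rel_setI rel_setU rel_set0.

Lemma rel_valI (x y : relAlg) : val (x `&` y)%O = (val x `&` val y)%O.
Proof. by []. Qed.

Lemma rel_valU (x y : relAlg) : val (x `|` y)%O = (val x `|` val y)%O.
Proof. by []. Qed.

Lemma rel_val0 : val (\bot%O : relAlg) = \bot%O.
Proof. by []. Qed.

Fact rel_meetUl : left_distributive (@Order.meet d relAlg) (@Order.join d relAlg).
Proof.
move=> x y z; apply: val_inj.
by rewrite !(rel_valI, rel_valU) meetUl.
Qed.

HB.instance Definition _ :=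
  Order.Lattice_Meet_isDistrLattice.Build d relAlg rel_meetUl.

Fact rel_set1 : a \in rel_set.
Proof. by rewrite rel_setE. Qed.

Fact rel_lex1 (x : relAlg) : (x <= RelAlg rel_set1)%O.
Proof. by rewrite -Order.le_val /= -rel_setE; exact: valP. Qed.

HB.instance Definition _ := Order.hasTop.Build d relAlg rel_lex1.

Fact rel_setC (x : relAlg) : (a `&` ~` (val x))%O \in rel_set.
Proof. by rewrite rel_setE leIl. Qed.

Definition rel_compl (x : relAlg) : relAlg := RelAlg (rel_setC x).

Fact rel_joinxC (x : relAlg) : (x `|` rel_compl x = \top)%O.
Proof.
apply: val_inj; rewrite rel_valU /= joinIr joinxC meetx1.
by apply/join_idPr; rewrite -rel_setE; exact: valP.
Qed.

Fact rel_meetxC (x : relAlg) : (x `&` rel_compl x = \bot)%O.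
Proof. by apply: val_inj; rewrite rel_valI rel_val0 /= meetCA meetxC meetx0. Qed.

HB.instance Definition _ := Order.TBDistrLattice_hasComplement.Build d relAlg
  rel_joinxC rel_meetxC.

End relAlg.

Section idealAlg.
Context (d : Order.disp_t) (A : ctbDistrLatticeType d) (I : properIdeal A).

(* [dual_filter] is I^*, and [idealAlg] is the algebra A<I>. *)
Definition dual_filter : set A := [set (~` x)%O | x in ideal_set I].

Definition ideal_alg_set : set A := ideal_set I `|` dual_filter.

Record idealAlg :=
  IdealAlg { ideal_alg_val : A; ideal_alg_valP : ideal_alg_val \in ideal_alg_set }.

HB.instance Definition _ := [isSub for ideal_alg_val].
HB.instance Definition _ := [Choice of idealAlg by <:].

Lemma dual_filterE (x : A) : dual_filter x <-> ideal_set I (~` x)%O.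
Proof.
split=> [[y Iy <-]|Ix]; first by rewrite complK.
by exists (~` x)%O => //; rewrite complK.
Qed.

Fact ideal_alg_setI :
  {in ideal_alg_set &, forall x y, (x `&` y)%O \in ideal_alg_set}.
Proof.
move=> x y; rewrite !inE => -[Ix|/dual_filterE Ix].
  by move=> _; left; apply: ideal_le Ix; exact: leIl.
move=> [Iy|/dual_filterE Iy]; first by left; apply: ideal_le Iy; exact: leIr.
by right; apply/dual_filterE; rewrite complI; exact: idealU.
Qed.

Fact ideal_alg_setC (x : A) : x \in ideal_alg_set -> (~` x)%O \in ideal_alg_set.
Proof.
by rewrite !inE => -[Ix|/dual_filterE Ix]; [right; exists x|left].
Qed.

Fact ideal_alg_setU :
  {in ideal_alg_set &, forall x y, (x `|` y)%O \in ideal_alg_set}.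
Proof.
move=> x y Ix Iy; rewrite -[(x `|` y)%O]complK complU.
by apply/ideal_alg_setC/ideal_alg_setI; exact: ideal_alg_setC.
Qed.

Fact ideal_alg_set0 : \bot%O \in ideal_alg_set.
Proof. by rewrite inE; left; exact: ideal0. Qed.

Fact ideal_alg_set1 : \top%O \in ideal_alg_set.
Proof. by rewrite -compl0; exact/ideal_alg_setC/ideal_alg_set0. Qed.

HB.instance Definition _ := Order.SubChoice_isTBSubLattice.Build d A
  (fun x => x \in ideal_alg_set) d idealAlg
  ideal_alg_setI ideal_alg_setU ideal_alg_set0 ideal_alg_set1.

Lemma ideal_alg_valI (x y : idealAlg) : val (x `&` y)%O = (val x `&` val y)%O.
Proof. by []. Qed.

Lemma ideal_alg_valU (x y : idealAlg) : val (x `|` y)%O = (val x `|` val y)%O.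
Proof. by []. Qed.

Lemma ideal_alg_val0 : val (\bot%O : idealAlg) = \bot%O.
Proof. by []. Qed.

Lemma ideal_alg_val1 : val (\top%O : idealAlg) = \top%O.
Proof. by []. Qed.

Fact ideal_alg_meetUl :
  left_distributive (@Order.meet d idealAlg) (@Order.join d idealAlg).
Proof.
move=> x y z; apply: val_inj.
by rewrite !(ideal_alg_valI, ideal_alg_valU) meetUl.
Qed.

HB.instance Definition _ :=
  Order.Lattice_Meet_isDistrLattice.Build d idealAlg ideal_alg_meetUl.

Definition ideal_alg_compl (x : idealAlg) : idealAlg :=
  IdealAlg (ideal_alg_setC (valP x)).

Fact ideal_alg_joinxC (x : idealAlg) : (x `|` ideal_alg_compl x = \top)%O.
Proof. by apply: val_inj; rewrite ideal_alg_valU ideal_alg_val1 /= joinxC. Qed.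

Fact ideal_alg_meetxC (x : idealAlg) : (x `&` ideal_alg_compl x = \bot)%O.
Proof. by apply: val_inj; rewrite ideal_alg_valI ideal_alg_val0 /= meetxC. Qed.

HB.instance Definition _ := Order.TBDistrLattice_hasComplement.Build d idealAlg
  ideal_alg_joinxC ideal_alg_meetxC.

End idealAlg.

Section stone.
Context (d : Order.disp_t) (B : ctbDistrLatticeType d).

Definition proper_filter (F : set B) : Prop :=
  [/\ F \top%O,
      forall x y, F x -> F y -> F (x `&` y)%O,
      forall x y, (x <= y)%O -> F x -> F y
    & ~ F \bot%O].

Definition ultrafilter (F : set B) : Prop :=
  proper_filter F /\ forall G, proper_filter G -> F `<=` G -> G = F.

Record stone := Stone { stone_set : set B; stoneP : ultrafilter stone_set }.

HB.instance Definition _ := gen_eqMixin stone.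
HB.instance Definition _ := gen_choiceMixin stone.

Definition stone_clopen (x : B) : set stone := [set p | stone_set p x].

Fact stone_cover : \bigcup_(U in range stone_clopen) id U = [set: stone].
Proof.
apply/seteqP; split => // p _; exists (stone_clopen \top%O); first by exists \top%O.
by case: (stoneP p) => -[].
Qed.

Fact stone_join (U V : set stone) (p : stone) :
  range stone_clopen U -> range stone_clopen V -> id U p -> id V p ->
  exists W, [/\ range stone_clopen W, id W p & id W `<=` id U `&` id V].
Proof.
move=> [x _ <-] [y _ <-] px py; exists (stone_clopen (x `&` y)%O); split.
- by exists (x `&` y)%O.
- by case: (stoneP p) => -[_ pI _ _] _; exact: pI.
move=> q qxy; case: (stoneP q) => -[_ _ qle _] _.
by split; apply: qle qxy; [exact: leIl|exact: leIr].
Qed.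

HB.instance Definition _ := isBaseTopological.Build stone stone_cover stone_join.

End stone.

Section point.
Context (d : Order.disp_t) (A : ctbDistrLatticeType d) (I : properIdeal A).

Fact dual_filter_ultra :
  ultrafilter [set x : idealAlg I | dual_filter I (val x)].
Proof.
split=> [|G [_ GI _ G0] FG].
  split=> /=.
  - by exists \bot%O; [exact: ideal0|rewrite compl0].
  - move=> x y /dual_filterE Ix /dual_filterE Iy; apply/dual_filterE.
    by rewrite complI; exact: idealU.
  - move=> x y xy /dual_filterE Ix; apply/dual_filterE.
    by apply: ideal_le Ix; rewrite leC Order.le_val.
  - by move/dual_filterE; rewrite compl0; exact: ideal1.
apply/seteqP; split=> // x Gx /=.
have := valP x; rewrite inE => -[Ix|//].
exfalso; apply: G0; rewrite -(meetxC x); apply: GI => //; apply: FG => /=.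
by exists (val x).
Qed.

(* The point p_{I^*}; it also serves as the base point that measurable types
   are required to have. *)
Definition dual_point : stone (idealAlg I) := Stone dual_filter_ultra.

HB.instance Definition _ := isPointed.Build (stone (idealAlg I)) dual_point.

End point.

Section nikodym.
Context (R : realType) (d : Order.disp_t) (B : ctbDistrLatticeType d).

Definition finitely_additive (mu : B -> R) : Prop :=
  forall x y, (x `&` y = \bot)%O -> mu (x `|` y)%O = mu x + mu y.

Definition bounded_function (mu : B -> R) : Prop :=
  exists M : R, forall x, `|mu x| <= M.

Definition variation_norm (mu : B -> R) : \bar R :=
  ereal_sup [set z | exists x y,
    (x `&` y = \bot)%O /\ z = (`|mu x| + `|mu y|)%:E].

Definition nikodym : Prop :=
  forall mu : nat -> B -> R,
    (forall n, finitely_additive (mu n) /\ bounded_function (mu n)) ->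
    (forall x, mu n x @[n --> \oo] --> (0 : R)) ->
    exists M : R, forall n, (variation_norm (mu n) <= M%:E)%E.

End nikodym.

Definition borel (T : ptopologicalType) := g_sigma_algebraType (@open T).
HB.instance Definition _ (T : ptopologicalType) := Measurable.on (borel T).

Section radon.
Context (R : realType) (T : ptopologicalType).
Implicit Type mu : {finite_measure set (borel T) -> \bar R}.
Local Open Scope ereal_scope.

(* A non-negative Radon measure is a finite Borel measure that is regular. *)
Definition regular_measure mu : Prop :=
  forall E : set (borel T), measurable E ->
    mu E = ereal_sup [set mu K | K in [set K : set T | compact K /\ K `<=` E]] /\
    mu E = ereal_inf [set mu U | U in [set U : set T | open U /\ E `<=` U]].

Definition msupport mu : set T :=
  [set p | forall U : set T, open U -> U p -> 0 < mu U].

(* The variation norm on the Boolean algebra of Borel sets. *)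
Definition measure_norm mu : \bar R :=
  ereal_sup [set z | exists E F : set (borel T),
    [/\ measurable E, measurable F, E `&` F = set0 & z = `|mu E| + `|mu F|]].

End radon.

Section sequences.
Context (R : realType) (d : Order.disp_t) (A : ctbDistrLatticeType d).
Context (I : properIdeal A).
Implicit Type mu : nat -> {finite_measure set (borel (stone (idealAlg I))) -> \bar R}.

Definition escaping_radon_sequence mu : Prop :=
  [/\ forall n, regular_measure (mu n),
      forall n, ~ msupport (mu n) (dual_point I),
      ereal_sup (range (fun n => measure_norm (mu n))) = +oo%E
    & forall x : idealAlg I, ideal_set I (val x) ->
        mu n (stone_clopen x) @[n --> \oo] --> 0%E].

Definition disjointly_supported mu : Prop :=
  forall m n, m <> n -> msupport (mu m) `&` msupport (mu n) = set0.

End sequences.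

(* Main.v *)
(* An escaping sequence (mu_n) refutes the Nikodym property of A<I>: subtract
   from mu_n its total mass placed at p_{I^*}; the result tends to 0 pointwise
   but is unbounded.

   Conversely, let (mu_n) be pointwise null and unbounded on A<I>. The Nikodym
   property of the algebras A_a bounds (mu_n) below each a in I, so one can pick
   pairwise disjoint a_k in I and indices n_k with |mu_{n_k}(a_k)| > (k+1)^2.
   Up to sign, the positive part of mu_{n_k} below a_k, divided by k+1, has norm
   at least k+1, and its value at a fixed x in I is at most M_x / (k+1). It
   extends to a Radon measure on the Stone space through the outer measure
   E |-> inf_{U open, E <= U} sup_{[x] <= U} m x. The Borel sigma-algebra may be
   larger than the one generated by the clopen sets, which is why Caratheodory's
   criterion is checked on all open sets. *)

Require Import Defs.
From HB Require Import structures.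
From mathcomp Require Import all_boot all_order all_algebra.
From mathcomp Require Import all_classical all_reals all_analysis.
From mathcomp Require Import ring.

Set Implicit Arguments.
Unset Strict Implicit.
Unset Printing Implicit Defensive.

Import Order.Theory GRing.Theory Num.Theory.
Import numFieldNormedType.Exports.

Local Open Scope classical_set_scope.
Local Open Scope ring_scope.

(** * Ultrafilters and the topology of the Stone space *)

Section stone_space.
Context (d : Order.disp_t) (B : ctbDistrLatticeType d).
Implicit Types (x y z : B) (p : stone B).

Lemma prime_filter_ultra (F : set B) :
  proper_filter F -> (forall x, F x \/ F (~` x)%O) -> ultrafilter F.
Proof.
move=> PF primeF; split=> // G [_ GI _ G0] FG; apply/seteqP; split=> // x Gx.
have [//|Fx] := primeF x.
by exfalso; apply: G0; rewrite -(meetxC x); apply: GI => //; exact: FG.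
Qed.

(** If no member of [F] is disjoint from [x], then [F] and [x] generate a proper filter, which
    maximality identifies with [F]. *)
Lemma ultrafilter_prime (F : set B) x : ultrafilter F -> F x \/ F (~` x)%O.
Proof.
move=> [[F1 FI Fle F0] maxF].
have [[y Fy yx0]|Fx] := pselect (exists2 y, F y & (y `&` x = \bot)%O).
  by right; apply: Fle Fy; rewrite -disj_leC yx0.
left; pose G := [set z | exists2 y, F y & (y `&` x <= z)%O].
suff <- : G = F by exists \top%O => //; exact: leIr.
apply: maxF; last by move=> y Fy; exists y => //; exact: leIl.
split.
- by exists \top%O => //; exact: lex1.
- move=> y z [u Fu uy] [v Fv vz]; exists (u `&` v)%O; first exact: FI.
  rewrite lexI (le_trans _ uy) ?(le_trans _ vz)// leI2//.
    exact: leIr.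
  exact: leIl.
- by move=> y z yz [u Fu uy]; exists u => //; exact: le_trans yz.
- by move=> [y Fy]; rewrite lex0 => /eqP yx0; apply: Fx; exists y.
Qed.

Lemma exists_ultrafilter x : x != \bot%O -> exists p, stone_set p x.
Proof.
move=> x0.
pose P (F : set B) := F = set0 \/ proper_filter F /\ F x.
have [C CP Ctot|F [PF maxF]] := @Zorn_bigcup B P.
  have [[X CX [y Xy]]|C0] := pselect (exists2 X, C X & X !=set0); last first.
    left; apply/seteqP; split=> // y [X CX Xy].
    by apply: C0; exists X => //; exists y.
  have filterC Y z : C Y -> Y z -> proper_filter Y /\ Y x.
    by move=> /CP[->//|//].
  right; split; last by exists X => //; exact: (filterC _ _ CX Xy).2.
  split.
  - by exists X => //; have [[]] := filterC _ _ CX Xy.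
  - move=> u v [Y CY Yu] [Z CZ Zv].
    have [[_ YI _ _] _] := filterC _ _ CY Yu.
    have [[_ ZI _ _] _] := filterC _ _ CZ Zv.
    have [YZ|ZY] := Ctot _ _ CY CZ.
      by exists Z => //; apply: ZI => //; exact: YZ.
    by exists Y => //; apply: YI => //; exact: ZY.
  - move=> u v uv [Y CY Yu]; exists Y => //.
    by have [[_ _ Yle _] _] := filterC _ _ CY Yu; exact: Yle Yu.
  - by move=> [Y CY Y0]; have [[_ _ _]] := filterC _ _ CY Y0.
have Px : P [set y | (x <= y)%O].
  right; split=> //=; split=> /=.
  - exact: lex1.
  - by move=> u v xu xv; rewrite lexI xu.
  - by move=> u v uv xu; exact: le_trans uv.
  - by rewrite lex0; exact/negP.
case: PF => [F0|[FF Fx]].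
  exfalso; apply: maxF Px; rewrite F0; split; first exact: sub0set.
  by move=> /(_ x); apply=> /=.
suff UF : ultrafilter F by exists (Stone UF).
split=> // G FG FsubG; apply/seteqP; split=> //; apply: contrapT => GF.
by apply: (maxF G); [split|right; split=> //; exact: FsubG].
Qed.

Lemma stone_setI p x y :
  stone_set p (x `&` y)%O <-> stone_set p x /\ stone_set p y.
Proof.
have [[_ pI ple _] _] := stoneP p; split=> [pxy|[]]; last exact: pI.
by split; apply: ple pxy; rewrite ?leIl ?leIr.
Qed.

Lemma stone_set0 p : ~ stone_set p \bot%O.
Proof. by have [[]] := stoneP p. Qed.

Lemma stone_set1 p : stone_set p \top%O.
Proof. by have [[]] := stoneP p. Qed.

Lemma stone_setC p x : stone_set p (~` x)%O <-> ~ stone_set p x.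
Proof.
split=> [pCx px|npx].
  by apply: (@stone_set0 p); rewrite -(meetxC x); exact/stone_setI.
by have [] := ultrafilter_prime x (stoneP p).
Qed.

Lemma stone_clopenI x y :
  stone_clopen (x `&` y)%O = stone_clopen x `&` stone_clopen y.
Proof. by apply/seteqP; split=> p /stone_setI. Qed.

Lemma stone_clopenC x : stone_clopen (~` x)%O = ~` stone_clopen x.
Proof. by apply/seteqP; split=> p /stone_setC. Qed.

Lemma stone_clopenU x y :
  stone_clopen (x `|` y)%O = stone_clopen x `|` stone_clopen y.
Proof.
by rewrite -[LHS]setCK -stone_clopenC complU stone_clopenI !stone_clopenC setCI
  !setCK.
Qed.

Lemma stone_clopen0 : stone_clopen (\bot%O : B) = set0.
Proof. by apply/seteqP; split=> // p /stone_set0. Qed.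

Lemma stone_clopen1 : stone_clopen (\top%O : B) = setT.
Proof. by apply/seteqP; split=> // p _; exact: stone_set1. Qed.

Lemma stone_clopen_joins (s : seq B) :
  stone_clopen (\join_(x <- s) x)%O = \bigcup_(x in [set` s]) stone_clopen x.
Proof.
rewrite bigcup_seq; elim: s => [|x s IHs].
  by rewrite !big_nil stone_clopen0.
by rewrite !big_cons stone_clopenU IHs.
Qed.

(** Otherwise the meet of [x] with the complement of [y] is nonzero, and an ultrafilter containing
    it lies in [x] but not in [y]. *)
Lemma stone_clopen_subset x y :
  stone_clopen x `<=` stone_clopen y -> (x <= y)%O.
Proof.
move=> xy; rewrite -[y]complK -disj_leC; apply/eqP; apply: contrapT => /eqP.
by move=> /exists_ultrafilter[p /stone_setI[/xy py /stone_setC]].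
Qed.

Lemma open_stone_clopen x : open (stone_clopen x).
Proof.
by exists [set stone_clopen x]; [move=> _ ->; exists x|rewrite bigcup_set1].
Qed.

Lemma open_stoneP (U : set (stone B)) p : open U -> U p ->
  exists2 x, stone_set p x & stone_clopen x `<=` U.
Proof.
move=> [D DB <-] [V DV Vp]; have [x _ xV] := DB _ DV.
by exists x; [move: Vp; rewrite -xV|rewrite xV => q Vq; exists V].
Qed.

(* An ultrafilter of sets F converges to the ultrafilter {x | F [x]}. *)
Lemma stone_compact : compact [set: stone B].
Proof.
rewrite compact_ultra => F UF _.
have PF : proper_filter [set x | F (stone_clopen x)].
  split=> /=.
  - by rewrite stone_clopen1; exact: filterT.
  - by move=> x y Fx Fy; rewrite stone_clopenI; exact: filterI.
  - move=> x y xy; apply: filterS => q qx.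
    by have [[_ _ qle _] _] := stoneP q; exact: qle qx.
  - by rewrite stone_clopen0; exact: filter_not_empty.
have primeF x : F (stone_clopen x) \/ F (stone_clopen (~` x)%O).
  by rewrite stone_clopenC; exact: in_ultra_setVsetC.
exists (Stone (prime_filter_ultra PF primeF)); split=> // V /=.
rewrite nbhsE => -[U [oU Up] UV].
have [x Fx xU] := open_stoneP oU Up.
by apply: filterS Fx => q /xU /UV.
Qed.

End stone_space.

(** * Finitely additive functions on a Boolean algebra *)

Section finitely_additive_theory.
Context (R : realType) (d : Order.disp_t) (B : ctbDistrLatticeType d).
Variables (mu : B -> R) (mu_add : finitely_additive mu).
Implicit Types x y : B.

Lemma additive0 : mu \bot%O = 0.
Proof.
have := mu_add (meetxx \bot%O); rewrite joinxx => /eqP.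
by rewrite -subr_eq subrr eq_sym => /eqP.
Qed.

Lemma additive_split y x : mu x = mu (x `&` y)%O + mu (x `\` y)%O.
Proof.
rewrite -{1}(joinIB y x) mu_add//.
by rewrite diffE meetACA meetxC meetx0.
Qed.

Hypothesis mu_ge0 : forall x, 0 <= mu x.

Lemma additive_le x y : (x <= y)%O -> mu x <= mu y.
Proof. by move=> xy; rewrite (additive_split x y) (meet_idPr xy) lerDl. Qed.

Lemma additive_leU x y z : (x <= y `|` z)%O -> mu x <= mu y + mu z.
Proof.
move=> xyz; rewrite (additive_split y) lerD//; apply: additive_le.
  exact: leIr.
by rewrite leBLR.
Qed.

End finitely_additive_theory.

(** * Extension of a content on the clopen sets to a Radon measure *)

Section radon_extension.
Context (R : realType) (d : Order.disp_t) (A : ctbDistrLatticeType d).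
Context (I : properIdeal A).
Local Notation B := (idealAlg I).
Local Notation T := (stone B).
Local Open Scope ereal_scope.

Record content := Content {
  content_fun :> B -> R;
  content_ge0 : forall x, (0 <= content_fun x)%R;
  content_add : finitely_additive content_fun }.

(** The clopen subsets of [U] cover [K]; the join of a finite subcover is the required element. *)
Lemma compact_open_clopen (K U : set T) : compact K -> open U -> K `<=` U ->
  exists2 x : B, K `<=` stone_clopen x & stone_clopen x `<=` U.
Proof.
rewrite compact_cover => cK oU KU.
have [|p Kp|s sU Ks] := cK B [set x | stone_clopen x `<=` U]
  (@stone_clopen _ B).
- by move=> x _; exact: open_stone_clopen.
- have [x px xU] := open_stoneP oU (KU _ Kp).
  by exists x.
exists (\join_(x <- finmap.enum_fset s) x)%O; rewrite stone_clopen_joins.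
  by move=> p /Ks[x /= xs px]; exists x.
move=> p [x /= xs px]; have /(_ _ xs) := sU.
by rewrite inE; apply.
Qed.

Lemma closed_stone_clopen (x : B) : closed (stone_clopen x).
Proof.
rewrite -[stone_clopen x]setCK -stone_clopenC; apply: open_closedC.
exact: open_stone_clopen.
Qed.

Lemma compact_stone_clopen (x : B) : compact (stone_clopen x).
Proof.
by apply: (subclosed_compact _ (@stone_compact _ B)) => //;
  exact: closed_stone_clopen.
Qed.

Variable m : content.

Lemma content0 : (m \bot%O)%:E = 0.
Proof. by rewrite (additive0 (@content_add m)). Qed.

Definition open_content (U : set T) : \bar R :=
  ereal_sup [set (m x)%:E | x in [set x | stone_clopen x `<=` U]].

Definition content_outer (E : set T) : \bar R :=
  ereal_inf [set open_content U | U in [set U | open U /\ E `<=` U]].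

Lemma open_content_ge (x : B) U : stone_clopen x `<=` U ->
  (m x)%:E <= open_content U.
Proof. by move=> xU; apply: ereal_sup_ubound; exists x. Qed.

Lemma open_content_ge0 U : 0 <= open_content U.
Proof.
by rewrite -content0; apply: open_content_ge; rewrite stone_clopen0.
Qed.

Lemma le_open_content U V : U `<=` V -> open_content U <= open_content V.
Proof.
move=> UV; apply: ereal_sup_le => _ [x xU <-]; exists x => //.
exact: subset_trans UV.
Qed.

Lemma open_content_clopen (x : B) : open_content (stone_clopen x) = (m x)%:E.
Proof.
apply/eqP; rewrite eq_le open_content_ge// andbT; apply: ge_ereal_sup.
move=> _ [y /stone_clopen_subset yx <-]; rewrite lee_fin.
by apply: additive_le yx; [exact: content_add|exact: content_ge0].
Qed.

(** For [x] inside the union, the part of [x] outside [V] is compact and lies in [U], so some clopen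
    [y] inside [U] contains it. What remains of [x] after removing [y] lies in [V]. *)
Lemma open_contentU U V : open U -> open V ->
  open_content (U `|` V) <= open_content U + open_content V.
Proof.
move=> oU oV; apply: ge_ereal_sup => _ [x xUV <-].
have [|p [px nVp]|y xVy yU] := @compact_open_clopen (stone_clopen x `\` V) U _ oU.
- apply: (subclosed_compact _ (@compact_stone_clopen x)); last exact: subIsetl.
  by apply: closedI; [exact: closed_stone_clopen|exact: open_closedC].
- by have [] := xUV _ px.
have zV : stone_clopen (x `\` y)%O `<=` V.
  move=> p; rewrite diffE => /stone_setI[px /stone_setC npy].
  by apply: contrapT => nVp; apply: npy; apply: xVy.
apply: (@le_trans _ _ (m y + m (x `\` y)%O)%:E).
  rewrite lee_fin; apply: additive_leU; [exact: content_add|exact: content_ge0|].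
  by rewrite -leBLR.
by rewrite EFinD leeD// open_content_ge.
Qed.

Lemma open_content_bigcup (U : (set T)^nat) : (forall n, open (U n)) ->
  open_content (\bigcup_n U n) <= \sum_(n <oo) open_content (U n).
Proof.
move=> oU; apply: ge_ereal_sup => _ [x xU <-].
have := @compact_stone_clopen x; rewrite compact_cover.
move=> /(_ nat setT U (fun n _ => oU n) xU)[s _ xs].
(* [N] exceeds every index of the finite subcover, so [x] lies in the union of the first [N] sets,
   where finite subadditivity suffices. *)
pose N := (\max_(n <- finmap.enum_fset s) n).+1.
have finU n : open (\big[setU/set0]_(i < n) U i) /\
    open_content (\big[setU/set0]_(i < n) U i) <= \sum_(i < n) open_content (U i).
  elim: n => [|n [IHo IHn]].
    rewrite !big_ord0 -(stone_clopen0 B) open_content_clopen content0.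
    by split=> //; exact: open_stone_clopen.
  rewrite !big_ord_recr /=; split; first exact: openU.
  by apply: le_trans (open_contentU IHo (oU n)) _; exact: leeD2r.
apply: (@le_trans _ _ (\sum_(i < N) open_content (U i))).
  apply: le_trans (finU N).2; apply: open_content_ge => p /xs[n /= ns Unp].
  have nN : (n < N)%N by rewrite ltnS; exact: leq_bigmax_seq.
  by rewrite (bigD1 (Ordinal nN))//=; left.
rewrite -(big_mkord xpredT (open_content \o U)) /=.
by apply: nneseries_lim_ge => n _ _; exact: open_content_ge0.
Qed.

Lemma content_outer_ge0 E : 0 <= content_outer E.
Proof. by apply: le_ereal_inf_tmp => _ [U _ <-]; exact: open_content_ge0. Qed.

Lemma content_outer_le E U : open U -> E `<=` U ->
  content_outer E <= open_content U.
Proof. by move=> oU EU; apply: ereal_inf_lbound; exists U. Qed.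

Lemma content_outer_open U : open U -> content_outer U = open_content U.
Proof.
move=> oU; apply/eqP; rewrite eq_le content_outer_le//=.
by apply: le_ereal_inf_tmp => _ [V [_ UV] <-]; exact: le_open_content.
Qed.

Lemma content_outer_clopen (x : B) :
  content_outer (stone_clopen x) = (m x)%:E.
Proof.
by rewrite content_outer_open ?open_content_clopen//; exact: open_stone_clopen.
Qed.

Lemma content_outer0 : content_outer set0 = 0.
Proof.
by rewrite -(stone_clopen0 B) content_outer_clopen content0.
Qed.

Lemma le_content_outer :
  {homo content_outer : E F / E `<=` F >-> E <= F}.
Proof.
move=> E F EF; apply: ereal_inf_le_tmp => _ [U [oU FU] <-].
by exists U => //; split=> //; exact: subset_trans FU.
Qed.

Lemma content_outer_fin E : content_outer E \is a fin_num.
Proof.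
rewrite ge0_fin_numE ?content_outer_ge0//.
apply: (@le_lt_trans _ _ (content_outer [set: T])); first exact: le_content_outer.
by rewrite -(stone_clopen1 B) content_outer_clopen ltry.
Qed.

Lemma content_outer_sigma_subadditive : sigma_subadditive content_outer.
Proof.
move=> E; apply/lee_addgt0Pr => e e0.
apply: le_trans (epsilon_trick _ _ _) => [|n|]; last 2 first.
- exact: content_outer_ge0.
- exact: ltW.
(* Each [E n] is covered by an open set with excess at most [e / 2 ^ n.+1]; these excesses add up to
   [e]. *)
pose P n U := [/\ open U, E n `<=` U &
  open_content U <= content_outer (E n) + (e / (2 ^ n.+1)%:R)%:E].
have [U PU] : {U : (set T)^nat & forall n, P n (U n)}.
  apply: (@choice _ _ P) => n.
  have en0 : (0 < e / (2 ^ n.+1)%:R)%R by rewrite divr_gt0// ltr0n expn_gt0.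
  have [_ [U [oU EU] <-] /ltW] :=
    lb_ereal_inf_adherent en0 (content_outer_fin (E n)).
  by exists U.
apply: (@le_trans _ _ (\sum_(n <oo) open_content (U n))).
  apply: le_trans (open_content_bigcup _); last by move=> n; have [] := PU n.
  apply: content_outer_le; first by apply: bigcup_open => n _; have [] := PU n.
  by apply: subset_bigcup => n _; have [] := PU n.
apply: lee_nneseries => [n _ _|n _]; first exact: open_content_ge0.
by have [] := PU n.
Qed.

HB.instance Definition _ := isOuterMeasure.Build R T content_outer
  content_outer0 content_outer_ge0 le_content_outer
  content_outer_sigma_subadditive.

(** Given an open [V] containing [E], take a clopen [x] inside the intersection of [V] and [U], then
    a clopen [y] inside [V] minus [x]. As [x] and [y] are disjoint, [m x + m y] is at most the
    content of [V]. The supremum over [y] bounds the part of [E] outside [U], and the supremum over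
    [x] the part inside. *)
Lemma open_caratheodory (U : set T) : open U ->
  (content_outer).-caratheodory U.
Proof.
move=> oU; apply: le_caratheodory_measurable => E.
apply: le_ereal_inf_tmp => _ [V [oV EV] <-].
rewrite -leeBrDr ?content_outer_fin//.
apply: (@le_trans _ _ (open_content (V `&` U))).
  apply: content_outer_le; first exact: openI.
  exact: setSI.
apply: ge_ereal_sup => _ [x xVU <-].
rewrite leeBrDr ?content_outer_fin// addeC -leeBrDr//.
apply: (@le_trans _ _ (open_content (V `\` stone_clopen x))).
  apply: content_outer_le.
    rewrite setDE -stone_clopenC; apply: openI => //.
    exact: open_stone_clopen.
  by move=> p [/EV Vp nUp]; split=> // /xVU[].
apply: ge_ereal_sup => _ [y yVx <-].
rewrite leeBrDr// -EFinD -(@content_add m); last first.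
  apply/eqP; apply: contrapT => /negP/exists_ultrafilter[p].
  by move=> /stone_setI[/yVx[]].
by apply: open_content_ge; rewrite stone_clopenU subUset; split=> p;
  [move=> /yVx[]|move=> /xVU[]].
Qed.

Lemma borel_caratheodory (E : set (borel T)) : measurable E ->
  (content_outer).-caratheodory E.
Proof.
apply: smallest_sub; last exact: open_caratheodory.
split.
- exact: caratheodory_measurable_set0.
- by move=> F; rewrite setTD; exact: caratheodory_measurable_setC.
- exact: caratheodory_measurable_bigcup.
Qed.

Definition radon_of_content (E : set (borel T)) : \bar R := content_outer E.

Let radon0 : radon_of_content set0 = 0.
Proof. exact: content_outer0. Qed.

Let radon_ge0 E : 0 <= radon_of_content E.
Proof. exact: content_outer_ge0. Qed.

Let radon_sigma_additive : semi_sigma_additive radon_of_content.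
Proof.
move=> E mE tE mUE.
apply: (@caratheodory_measure_sigma_additive R T content_outer) => //.
- by move=> n; exact: borel_caratheodory.
- exact: borel_caratheodory.
Qed.

HB.instance Definition _ := isMeasure.Build _ _ _ radon_of_content
  radon0 radon_ge0 radon_sigma_additive.

Let radon_fin : fin_num_fun radon_of_content.
Proof. by move=> E _; exact: content_outer_fin. Qed.

HB.instance Definition _ := Measure_isFinite.Build _ _ _ radon_of_content
  radon_fin.

Lemma radon_of_content_clopen (x : B) :
  radon_of_content (stone_clopen x) = (m x)%:E.
Proof. exact: content_outer_clopen. Qed.

(* Outer regularity holds by construction, and inner regularity is outer
   regularity of the complement, closed subsets being compact. *)
Lemma radon_of_content_regular : regular_measure radon_of_content.
Proof.
have outer E : radon_of_content E =
    ereal_inf [set radon_of_content U | U in [set U : set T | open U /\ E `<=` U]].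
  by congr ereal_inf; apply: eq_imagel => U [oU _]; rewrite -content_outer_open.
move=> E mE; split; last exact: outer.
apply/eqP; rewrite eq_le; apply/andP; split; last first.
  by apply: ge_ereal_sup => _ [K [_ KE] <-]; exact: le_content_outer.
apply/lee_addgt0Pr => e e0.
(* The complement of this [U] is the compact subset of [E] whose measure comes within [e] of that of
   [E]. *)
have := lb_ereal_inf_adherent e0 (content_outer_fin (~` E)).
move=> [_ [U [oU EU] <-]]; rewrite -content_outer_open// => /ltW UE.
(* The Caratheodory criterion tested on the whole space; finiteness of the measure allows the
   subtraction. *)
have mC (F : set (borel T)) : measurable F ->
    radon_of_content F = radon_of_content setT - radon_of_content (~` F).
  move=> mF; rewrite {2}/radon_of_content (borel_caratheodory mF setT) !setTI.
  by rewrite addeK//; exact: content_outer_fin.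
have mU : measurable (U : set (borel T)) by exact: sub_sigma_algebra.
apply: (@le_trans _ _ (radon_of_content (~` U) + e%:E)); last first.
  rewrite leeD2r//; apply: ereal_sup_ubound; exists (~` U) => //; split.
    apply: (subclosed_compact _ (@stone_compact _ B)) => //.
    exact: open_closedC.
  by rewrite -[E]setCK; exact: subsetC.
rewrite [leLHS](mC E mE) (mC (~` U)); last exact: measurableC.
rewrite setCK.
rewrite leeBlDr ?content_outer_fin//.
apply: (@le_trans _ _ (radon_of_content setT - radon_of_content U + radon_of_content U)).
  by rewrite subeK// content_outer_fin.
rewrite -!addeA leeD2l// leeD2l//.
by rewrite addeC.
Qed.

End radon_extension.

(** * The variation norm, and the Nikodym property of retracts *)

Section variation_norm.
Context (R : realType) (d : Order.disp_t) (B : ctbDistrLatticeType d).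

Lemma variation_norm_leP (mu : B -> R) (M : R) :
  (variation_norm mu <= M%:E)%E <->
  forall x y, (x `&` y = \bot)%O -> `|mu x| + `|mu y| <= M.
Proof.
split=> [muM x y xy|muM].
  by rewrite -lee_fin (le_trans _ muM)//; apply: ereal_sup_ubound; exists x, y.
by apply: ge_ereal_sup => _ [x [y [xy ->]]]; rewrite lee_fin muM.
Qed.

Lemma variation_norm_bound (mu : B -> R) (M : R) (x : B) :
  (variation_norm mu <= M%:E)%E -> `|mu x| <= M.
Proof.
move=> /variation_norm_leP /(_ _ _ (meetx0 x)); apply: le_trans.
by rewrite lerDl.
Qed.

End variation_norm.

(** The functions are pulled back along [f]. The norm bound comes back along the section [g], for
    which preserving disjointness is enough: the norm only involves disjoint pairs. *)
Lemma nikodym_retract (R : realType) (d d' : Order.disp_t)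
    (B : ctbDistrLatticeType d) (C : ctbDistrLatticeType d')
    (f : B -> C) (g : C -> B) :
  {morph f : x y / (x `&` y)%O} -> {morph f : x y / (x `|` y)%O} ->
  f \bot%O = \bot%O ->
  (forall x y, (x `&` y = \bot)%O -> (g x `&` g y = \bot)%O) ->
  cancel g f -> nikodym R B -> nikodym R C.
Proof.
move=> fI fU f0 gI gK nikB mu muP mu0.
have [n|x|M muM] := nikB (fun n => mu n \o f); last 1 first.
- exists M => n; apply/variation_norm_leP => x y xy.
  have /variation_norm_leP /(_ _ _ (gI _ _ xy)) := muM n.
  by rewrite /= !gK.
- have [mu_add [M muM]] := muP n; split; last by exists M => x; exact: muM.
  by move=> x y xy /=; rewrite fU mu_add// -fI xy.
- exact: mu0.
Qed.

(** * The positive part in the Jordan decomposition *)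

Section positive_part.
Context (R : realType) (d : Order.disp_t) (B : ctbDistrLatticeType d).
Variables (mu : B -> R) (mu_add : finitely_additive mu).
Hypothesis mu_bounded : bounded_function mu.
Implicit Types x y : B.

Let below x := [set mu y | y in [set y | (y <= x)%O]].

Definition positive_part x : R := sup (below x).

Let has_sup_below x : has_sup (below x).
Proof.
split; first by exists (mu x), x => /=.
by have [M muM] := mu_bounded; exists M => _ [y _ <-]; rewrite ler_normlW.
Qed.

Lemma le_positive_part x y : (y <= x)%O -> mu y <= positive_part x.
Proof.
by move=> yx; apply: sup_upper_bound => //; exists y.
Qed.

Lemma positive_part_le x M :
  (forall y, (y <= x)%O -> mu y <= M) -> positive_part x <= M.
Proof.
move=> muM; apply: ge_sup; first by have [] := has_sup_below x.
by move=> _ [y yx <-]; exact: muM.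
Qed.

Lemma positive_part_ge0 x : 0 <= positive_part x.
Proof. by rewrite -(additive0 mu_add); apply: le_positive_part; exact: le0x. Qed.

(** For disjoint [x] and [y], the elements below their join are exactly the joins of an element
    below [x] and one below [y], and the supremum of a sum of two sets is the sum of their
    suprema. *)
Lemma positive_part_add : finitely_additive positive_part.
Proof.
move=> x y xy; rewrite /positive_part -sup_sumE//; congr sup.
apply/seteqP; split=> [_ [z zxy <-]|_ [_ [u ux <-]] [_ [v vy <-] <-]].
  exists (mu (z `&` x)%O); first by exists (z `&` x)%O => //=; exact: leIr.
  exists (mu (z `\` x)%O); first by exists (z `\` x)%O => //=; rewrite leBLR.
  by rewrite -additive_split.
exists (u `|` v)%O; first exact: leU2.
by rewrite mu_add//; apply/eqP; rewrite -lex0 -xy; exact: leI2.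
Qed.

End positive_part.

(** * The ideal algebra and its restrictions below elements of the ideal *)

Section ideal_algebra.
Context (R : realType) (d : Order.disp_t) (A : ctbDistrLatticeType d).
Context (I : properIdeal A).
Local Notation B := (idealAlg I).
Implicit Types (x y : B) (a : A).

Lemma idealAlg_dichotomy x :
  ideal_set I (val x) \/ ideal_set I (val (~` x)%O).
Proof. by have := valP x; rewrite inE => -[|/dual_filterE]; [left|right]. Qed.

Lemma ideal_not_dual_point x :
  ideal_set I (val x) -> ~ stone_set (dual_point I) x.
Proof.
move=> Ix /dual_filterE ICx; apply: (@ideal1 _ _ I).
by rewrite -(joinxC (val x)); exact: idealU.
Qed.

Fact relAlg_in_ideal a (y : relAlg a) :
  ideal_set I a -> val y \in ideal_alg_set I.
Proof.
move=> Ia; rewrite inE; left; apply: ideal_le Ia.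
by rewrite -rel_setE; exact: valP.
Qed.

Definition relAlg_incl a (Ia : ideal_set I a) (y : relAlg a) : B :=
  IdealAlg (relAlg_in_ideal y Ia).

Fact relAlg_meet_in a x : (a `&` val x)%O \in rel_set a.
Proof. by rewrite rel_setE leIl. Qed.

Definition relAlg_restr a x : relAlg a := RelAlg (relAlg_meet_in a x).

(** Meeting with [a] retracts the ideal algebra onto the algebra below [a]. The inclusion is a
    section that preserves disjointness, though not the unit. *)
Lemma nikodym_relAlg a : ideal_set I a -> nikodym R B -> nikodym R (relAlg a).
Proof.
move=> Ia; apply: (@nikodym_retract R _ _ _ _ (relAlg_restr a) (relAlg_incl Ia)).
- by move=> x y; apply: val_inj; rewrite rel_valI /= meetACA meetxx.
- by move=> x y; apply: val_inj; rewrite rel_valU /= meetUr.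
- by apply: val_inj; rewrite rel_val0 /= meetx0.
- move=> x y /(congr1 val); rewrite rel_valI rel_val0 => xy.
  by apply: val_inj; rewrite ideal_alg_valI ideal_alg_val0.
- move=> x; apply: val_inj => /=; apply/meet_idPr.
  by rewrite -rel_setE; exact: valP.
Qed.

Lemma nikodym_relAlg_bound a (mu : nat -> B -> R) :
  ideal_set I a -> nikodym R (relAlg a) ->
  (forall n, finitely_additive (mu n) /\ bounded_function (mu n)) ->
  (forall x, mu n x @[n --> \oo] --> (0 : R)) ->
  exists M, forall n x, (val x <= a)%O -> `|mu n x| <= M.
Proof.
move=> Ia nika muP mu0.
have [n|y|M muM] := nika (fun n => mu n \o relAlg_incl Ia); last 1 first.
- exists M => n x xa; have xin : val x \in rel_set a by rewrite rel_setE.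
  have := variation_norm_bound (RelAlg xin) (muM n).
  by congr (`|mu n _| <= _); exact: val_inj.
- have [mu_add [M muM]] := muP n; split; last by exists M => x; exact: muM.
  move=> x y xy /=; rewrite -mu_add; last first.
    by apply: val_inj; move/(congr1 val): xy.
  by congr (mu n _); exact: val_inj.
- exact: mu0.
Qed.

(** The content is [c] times the positive part of [mu], with its sign chosen so that [mu a] becomes
    non-negative, restricted to elements below [a]. The first clause will transfer local bounds on
    [mu], the second gives large norm, and the third confines the support to [a]. *)
Lemma concentrated_content (mu : B -> R) (c : R) (a : B) :
  0 <= c -> finitely_additive mu -> bounded_function mu ->
  exists m : content R I,
    [/\ forall x M, (forall y, (y <= x)%O -> `|mu y| <= M) -> m x <= c * M,
        c * `|mu a| <= m \top%O & m (~` a)%O = 0].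
Proof.
move=> c0 mu_add [M0 muM0]; pose nu x := Num.sg (mu a) * mu x.
(* Equality of absolute values can fail: the sign is [0] when [mu a = 0]. *)
have nu_le x : nu x <= `|mu x|.
  rewrite (le_trans (ler_norm _))// normrM normr_sg.
  by case: (mu a != 0); rewrite ?mul1r// mul0r.
have nu_add : finitely_additive nu.
  by move=> x y xy; rewrite /nu mu_add// mulrDr.
have nu_bounded : bounded_function nu.
  exists M0 => x; rewrite (le_trans _ (muM0 x))// normrM normr_sg.
  by case: (mu a != 0); rewrite ?mul1r// mul0r.
pose m x := c * positive_part nu (x `&` a)%O.
have m_ge0 x : 0 <= m x by rewrite mulr_ge0// positive_part_ge0.
have m_add : finitely_additive m.
  move=> x y xy; rewrite /m -mulrDr meetUl positive_part_add//.
  by rewrite meetACA xy meet0x.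
exists (Content m_ge0 m_add); split=> [x M muM||] /=.
- rewrite ler_wpM2l//; apply: positive_part_le => // y.
  by rewrite lexI => /andP[yx _]; rewrite (le_trans (nu_le y))// muM.
- rewrite ler_wpM2l//= meet1x normrEsg; exact: le_positive_part.
- rewrite /m meetC meetxC; apply/eqP; rewrite mulf_eq0; apply/orP; right.
  by rewrite (additive0 (positive_part_add _ _)).
Qed.

(** For a non-negative measure the supremum over disjoint pairs is attained at the whole space and
    the empty set. *)
Lemma measure_normE
    (mu : {finite_measure set (borel (stone B)) -> \bar R}) :
  measure_norm mu = mu setT.
Proof.
apply/eqP; rewrite eq_le; apply/andP; split.
  apply: ge_ereal_sup => _ [E [F [mE mF EF ->]]].
  rewrite !gee0_abs// -measureU//; apply: le_measure => //; rewrite inE//.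
  exact: measurableU.
apply: ereal_sup_ubound; exists setT, set0; split=> //; first by rewrite setI0.
by rewrite measure0 abse0 adde0 gee0_abs.
Qed.

Lemma measurable_stone_clopen x :
  measurable (stone_clopen x : set (borel (stone B))).
Proof. by apply: sub_sigma_algebra; exact: open_stone_clopen. Qed.

End ideal_algebra.

(** * The Nikodym property against escaping sequences *)

Section nikodym_ideal_algebra.
Context (R : realType) (d : Order.disp_t) (A : ctbDistrLatticeType d).
Context (I : properIdeal A).
Local Notation B := (idealAlg I).
Local Notation radon_seq :=
  (nat -> {finite_measure set (borel (stone (idealAlg I))) -> \bar R}).

(* The witness is mu_n minus its total mass placed at the point p_{I^*}. *)
Lemma nikodym_no_escaping : nikodym R B ->
  ~ exists mu : radon_seq, escaping_radon_sequence mu.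
Proof.
move=> nikB [mu [_ mup mu_oo mu0]].
pose w n (x : B) : R := fine (mu n (stone_clopen x)).
pose dirac_p (x : B) : R := `[< stone_set (dual_point I) x >]%:R.
pose nu n x := w n x - dirac_p x * w n \top%O.
have wE n x : (w n x)%:E = mu n (stone_clopen x).
  by rewrite fineK// fin_num_measure//; exact: measurable_stone_clopen.
have w_ge0 n x : 0 <= w n x by rewrite fine_ge0.
have w_add n : finitely_additive (w n).
  move=> x y xy; apply: EFin_inj; rewrite EFinD !wE stone_clopenU measureU//.
  - exact: measurable_stone_clopen.
  - exact: measurable_stone_clopen.
  - by rewrite -stone_clopenI xy stone_clopen0.
have w_le n x : w n x <= w n \top%O.
  by apply: (additive_le (w_add n)) => //; exact: lex1.
have dirac_add : finitely_additive dirac_p.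
  move=> x y xy; rewrite /dirac_p.
  have xyp : ~ (stone_set (dual_point I) x /\ stone_set (dual_point I) y).
    by move=> /stone_setI; rewrite xy => /stone_set0.
  have -> : stone_set (dual_point I) (x `|` y)%O =
      (stone_set (dual_point I) x \/ stone_set (dual_point I) y).
    exact: (congr1 (fun S => S (dual_point I)) (stone_clopenU x y)).
  rewrite asbool_or; move: xyp => /asboolPn; rewrite asbool_and.
  by do 2 case: asboolP => //= _; rewrite ?addr0 ?add0r.
have [n|x|M nuM] := nikB nu; last 1 first.
- suff : (ereal_sup (range (fun n => measure_norm (mu n))) <= M%:E)%E.
    by rewrite mu_oo.
  apply: ge_ereal_sup => _ [n _ <-].
  rewrite measure_normE -(stone_clopen1 B) -wE lee_fin.
  (* Since the dual point is off the support, it has a null clopen neighbourhood [x]. All the mass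
     of [mu n] then sits on the complement of [x], where [nu n] and [w n] agree, so the bound on
     [nu] bounds the norm. *)
  have [U oU [Up /negP]] : exists2 U : set (stone B), open U &
      U (dual_point I) /\ ~ (0 < mu n U)%E.
    apply: contrapT => noU; apply: (mup n) => U oU Up.
    by apply: contrapT => U0; apply: noU; exists U.
  rewrite -leNgt => muU.
  have [x px xU] := open_stoneP oU Up.
  have wx0 : w n x = 0.
    apply: EFin_inj; rewrite wE; apply/eqP; rewrite eq_le measure_ge0 andbT.
    apply: le_trans muU; apply: le_measure => //; rewrite inE.
      exact: measurable_stone_clopen.
    exact: sub_sigma_algebra.
  have -> : w n \top%O = nu n (~` x)%O.
    rewrite /nu /dirac_p; case: asboolP => [/stone_setC//|_].
    by rewrite mul0r subr0 -(joinxC x) w_add ?meetxC// wx0 add0r.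
  by rewrite ler_normlW// variation_norm_bound.
- split.
    by move=> x y xy; rewrite /nu w_add// dirac_add//; ring.
  exists (w n \top%O + w n \top%O) => x.
  rewrite (le_trans (ler_normB _ _))// lerD//; first by rewrite ger0_norm.
  rewrite normrM [`|w _ _|]ger0_norm// ler_piMl// /dirac_p.
  by case: asboolP; rewrite ?normr1 ?normr0.
have w_cvg y : ideal_set I (val y) -> w n y @[n --> \oo] --> (0 : R).
  by move=> /mu0 /fine_cvg.
(* On the ideal [nu n] equals [w n]; off the ideal it is minus the value of [w n] at the complement.
   Both cases reduce to [w_cvg]. *)
have [Ix|ICx] := idealAlg_dichotomy x.
  rewrite (_ : nu^~ x = w^~ x); first exact: w_cvg.
  apply/funext => n; rewrite /nu /dirac_p.
  by case: asboolP => [/(ideal_not_dual_point Ix)//|]; rewrite mul0r subr0.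
rewrite (_ : nu^~ x = (fun n => - w n (~` x)%O)).
  by rewrite -oppr0; apply: cvgN; exact: w_cvg.
apply/funext => n; rewrite /nu /dirac_p.
have px : stone_set (dual_point I) x.
  by rewrite -[x]complK; apply/stone_setC; exact: ideal_not_dual_point.
rewrite asboolT// mul1r -(joinxC x) w_add ?meetxC//; ring.
Qed.

(** * From an unbounded pointwise null sequence to disjointly supported measures *)

Section from_unbounded_sequence.
Variable mu : nat -> B -> R.
Hypothesis muP : forall n, finitely_additive (mu n) /\ bounded_function (mu n).
Hypothesis mu_cvg0 : forall x, mu n x @[n --> \oo] --> (0 : R).
Hypothesis mu_unbounded :
  ~ exists M : R, forall n, (variation_norm (mu n) <= M%:E)%E.
Hypothesis mu_local_bound : forall a : A, ideal_set I a ->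
  exists M, forall n (x : B), (val x <= a)%O -> `|mu n x| <= M.

(* Since mu_n(1) -> 0, the mass of mu_n at p_{I^*} is controlled by its mass on
   the elements of I. *)
Lemma unbounded_on_ideal (K : R) :
  exists n (x : B), ideal_set I (val x) /\ K < `|mu n x|.
Proof.
apply: contrapT => bnd; apply: mu_unbounded.
have muK n (x : B) : ideal_set I (val x) -> `|mu n x| <= K.
  by move=> Ix; rewrite leNgt; apply/negP => Kx; apply: bnd; exists n, x.
have [C muC] : exists C, forall n, `|mu n \top%O| <= C.
  (* Boundedness only makes every number strictly above [C] a bound, hence [C + 1]. *)
  have /cvg_seq_bounded[C [_ /(_ (C + 1))]] : cvgn (mu^~ \top%O).
    by apply/cvg_ex; exists 0; exact: mu_cvg0.
  rewrite ltrDl ltr01 => /(_ isT) muC; exists (C + 1) => n; exact: muC.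
have C0 : 0 <= C by rewrite (le_trans _ (muC 0%N)).
have muCK n x : `|mu n x| <= C + K.
  have [Ix|ICx] := idealAlg_dichotomy x.
    by rewrite (le_trans (muK n x Ix))// lerDr.
  have [mu_add _] := muP n.
  have -> : mu n x = mu n \top%O - mu n (~` x)%O.
    by rewrite -(joinxC x) mu_add ?meetxC// addrK.
  by rewrite (le_trans (ler_normB _ _))// lerD// muK.
exists (C + K + (C + K)) => n; apply/variation_norm_leP => x y _.
by rewrite lerD.
Qed.

(** If [M] bounds all the functions below [b], a value exceeding [M + K] at [x] leaves more than [K]
    on [x] minus [b]. *)
Lemma unbounded_disjoint_from (b : B) (K : R) : ideal_set I (val b) ->
  exists n (a : B),
    [/\ ideal_set I (val a), (a `&` b = \bot)%O & K < `|mu n a|].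
Proof.
move=> /mu_local_bound[M muM]; have [n [x [Ix Kx]]] := unbounded_on_ideal (M + K).
exists n, (x `\` b)%O; split.
- by apply: ideal_le Ix; rewrite Order.le_val; exact: leBx.
- by rewrite diffE -meetA meetCx meetx0.
have [mu_add _] := muP n; rewrite -(ltrD2l M); apply: (lt_le_trans Kx).
rewrite (additive_split mu_add b) (le_trans (ler_normD _ _))// lerD2r muM//.
by rewrite Order.le_val; exact: leIr.
Qed.

Lemma disjoint_unbounded_sequence : exists (u : nat -> nat) (a : nat -> B),
  [/\ forall k, ideal_set I (val (a k)),
      forall j k, j <> k -> (a j `&` a k = \bot)%O
    & forall k, k.+1%:R ^+ 2 < `|mu (u k) (a k)|].
Proof.
(* Stating membership in the ideal as a premise makes [P] satisfiable for every pair, as the choice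
   principle demands; outside the ideal any value will do. *)
pose P (bk : B * nat) (na : nat * B) := ideal_set I (val bk.1) ->
  [/\ ideal_set I (val na.2), (na.2 `&` bk.1 = \bot)%O
    & bk.2.+1%:R ^+ 2 < `|mu na.1 na.2|].
have [f fP] : {f & forall bk, P bk (f bk)}.
  apply: (@choice _ _ P) => -[b k].
  have [Ib|nIb] := pselect (ideal_set I (val b)); last by exists (0%N, b).
  have [n [a abP]] := unbounded_disjoint_from (k.+1%:R ^+ 2) Ib.
  by exists (n, a).
(* [b k] is the join of [a 0], ..., [a k.-1], so choosing [a k] disjoint from it makes the whole
   sequence disjoint. *)
pose b k := iteri k (fun k b => b `|` (f (b, k)).2)%O (\bot%O : B).
pose a k := (f (b k, k)).2.
have bS k : b k.+1 = (b k `|` a k)%O by [].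
have Ib k : ideal_set I (val (b k)).
  elim: k => [|k IHk]; first exact: ideal0.
  by rewrite bS ideal_alg_valU; apply: idealU => //; have [] := fP (b k, k) IHk.
have ab j k : (j < k)%N -> (a j <= b k)%O.
  elim: k => // k IHk; rewrite ltnS leq_eqVlt bS => /predU1P[->|/IHk jk].
    exact: leUr.
  by rewrite lexU2// jk.
have disj j k : (j < k)%N -> (a j `&` a k = \bot)%O.
  move=> jk; apply/eqP; rewrite -lex0; have [_ <- _] := fP (b k, k) (Ib k).
  by rewrite meetC leI2// ab.
exists (fun k => (f (b k, k)).1), a; split=> [k|j k|k].
- by have [] := fP (b k, k) (Ib k).
- by move=> /eqP; rewrite neq_ltn => /orP[/disj//|/disj]; rewrite meetC.
- by have [] := fP (b k, k) (Ib k).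
Qed.

Lemma disjoint_escaping_sequence :
  exists nu : radon_seq, escaping_radon_sequence nu /\ disjointly_supported nu.
Proof.
have [u [a [Ia disj mu_a]]] := disjoint_unbounded_sequence.
pose P k (m : content R I) :=
  [/\ forall x M, (forall y, (y <= x)%O -> `|mu (u k) y| <= M) ->
        m x <= harmonic k * M,
      harmonic k * `|mu (u k) (a k)| <= m \top%O & m (~` a k)%O = 0].
have [m mP] : {m & forall k, P k (m k)}.
  apply: (@choice _ _ P) => k; have [mu_add mu_bnd] := muP (u k).
  by apply: concentrated_content => //; exact: harmonic_ge0.
pose nu : radon_seq := fun k => radon_of_content (m k).
(* The complement of [a k] is an open null set, so it misses the support. *)
have supp k : msupport (nu k) `<=` stone_clopen (a k).
  move=> p psupp; apply: contrapT => nap.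
  have := psupp _ (open_stone_clopen (~` a k)%O).
  have [_ _ mC0] := mP k.
  rewrite {1}/nu/= radon_of_content_clopen mC0 ltxx => false_p.
  by suff: false by []; apply: false_p; exact/stone_setC.
exists nu; split; last first.
  move=> j k jk; apply/seteqP; split=> // p [/supp pj /supp pk].
  by apply: (@stone_set0 _ _ p); rewrite -(disj _ _ jk); exact/stone_setI.
split.
- by move=> k; exact: radon_of_content_regular.
- by move=> k /supp; exact: ideal_not_dual_point.
- apply/eqyP => K K0.
  apply: (@le_trans _ _ (measure_norm (nu (Num.bound K)))).
    set k := Num.bound K; rewrite measure_normE -(stone_clopen1 B).
    rewrite /nu/= radon_of_content_clopen lee_fin.
    have [_ mT _] := mP k; apply: le_trans mT.
    (* The factor [harmonic k], which is 1/(k+1), leaves at least k+1 of a value above (k+1)^2, and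
       k+1 exceeds [K]. *)
    apply: (@le_trans _ _ k.+1%:R).
      by rewrite ltW// (lt_le_trans (archi_boundP (ltW K0)))// ler_nat.
    by rewrite /= mulrC ler_pdivlMr ?ltr0n// -expr2 ltW.
  by apply: ereal_sup_ubound; exists (Num.bound K).
move=> x Ix; have [M muM] := mu_local_bound Ix.
have nuE : (fun k => nu k (stone_clopen x)) = EFin \o (fun k => m k x).
  by apply/funext => k; rewrite /nu/= radon_of_content_clopen.
rewrite nuE; apply: cvg_EFin; first by near=> k.
(* The bound [M] below [x] is uniform in the index, so the harmonic factor alone forces convergence
   to [0]. *)
apply: (@squeeze_cvgr _ _ _ _ (cst 0) (fun k => harmonic k * M)).
- near=> k; rewrite /= content_ge0 /=; have [mM _ _] := mP k; apply: mM => y yx.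
  by apply: muM; rewrite Order.le_val.
- exact: cvg_cst.
- rewrite -[0](mul0r M); apply: cvgM; [exact: cvg_harmonic|exact: cvg_cst].
Unshelve. all: by end_near. Qed.

End from_unbounded_sequence.

End nikodym_ideal_algebra.

Theorem theorem4p14 (R : realType) (d : Order.disp_t)
    (A : ctbDistrLatticeType d) (I : properIdeal A) :
  [<-> nikodym R (idealAlg I);
       (forall a : A, ideal_set I a -> nikodym R (relAlg a)) /\
       ~ (exists mu : nat -> {finite_measure set (borel (stone (idealAlg I))) -> \bar R},
            escaping_radon_sequence mu);
       (forall a : A, ideal_set I a -> nikodym R (relAlg a)) /\
       ~ (exists mu : nat -> {finite_measure set (borel (stone (idealAlg I))) -> \bar R},
            escaping_radon_sequence mu /\ disjointly_supported mu)].

Proof.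
tfae.
- move=> nikB; split; first by move=> a Ia; exact: nikodym_relAlg nikB.
  exact: nikodym_no_escaping.
- by move=> [nik noseq]; split=> // -[mu [esc _]]; apply: noseq; exists mu.
- move=> [nik noseq] mu muP mu0; apply: contrapT => unbounded; apply: noseq.
  apply: (disjoint_escaping_sequence muP mu0 unbounded) => a Ia.
  exact: nikodym_relAlg_bound (nik a Ia) muP mu0.
Qed.
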